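(* There is a constant $\varepsilon>0$ such that any randomized algorithm which, given oracle access in the adjacency list model to a forest $G$ on $n$ vertices and a fixed forest $H$ on $n$ vertices, accepts with probability at least $2/3$ when $G$ is isomorphic to $H$ and rejects with probability at least $2/3$ when $d(G,H)\ge\varepsilon n$, must make $\Omega(\sqrt{\log n})$ queries.
   Context: Adjacency list model: the oracle answers degree queries (given $v$, return $\deg_G(v)$) and neighbor queries (given $v$ and $i$, return the $i$-th neighbor of $v$). For graphs $G,H$ with the same number of vertices, $d(G,H)$ is the minimum number of edge additions and removals needed to make $G$ isomorphic to $H$. *)

(* Defs.v *)
From HB Require Import structures.
From mathcomp Require Import all_boot all_order all_algebra all_fingroup.
From mathcomp Require Import all_classical all_reals all_analysis.

Set Implicit Arguments.
Unset Strict Implicit.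
Unset Printing Implicit Defensive.

Record sgraph (n : nat) := SGraph {
  edges : {set {set 'I_n}};
  edgesP : [forall e in edges, #|e| == 2] }.

HB.instance Definition _ (n : nat) := [isSub for @edges n].
HB.instance Definition _ (n : nat) := [Countable of sgraph n by <:].
HB.instance Definition _ (n : nat) := [Finite of sgraph n by <:].

Definition adj (n : nat) (G : sgraph n) : rel 'I_n :=
  fun u v => [set u; v] \in edges G.

Definition forest (n : nat) (G : sgraph n) : Prop :=
  forall c : seq 'I_n, 3 <= size c -> ~ ucycle (adj G) c.

Definition isomorphic (n : nat) (G H : sgraph n) : bool :=
  [exists s : {perm 'I_n}, forall u, forall v,
    adj G u v == adj H (s u) (s v)].

(* Number of edge additions plus number of edge removals turning G into F. *)
Definition edits (n : nat) (G F : sgraph n) : nat :=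
  #|edges F :\: edges G| + #|edges G :\: edges F|.

(* H is one of the graphs F isomorphic to H, so the default value [edits G H]
   of the iterated minimum is itself one of the values being minimized. *)
Definition dist (n : nat) (G H : sgraph n) : nat :=
  \big[Order.min/edits G H]_(F : sgraph n | isomorphic F H) edits G F.

(* The neighbors of each vertex are listed in an arbitrary order. *)
Record adjlist (n : nat) (G : sgraph n) := AdjList {
  nbrs : 'I_n -> seq 'I_n;
  nbrs_uniq : forall v, uniq (nbrs v);
  mem_nbrs : forall v u, (u \in nbrs v) = adj G v u }.

Variant query (n : nat) := Degree of 'I_n | Neighbor of 'I_n & nat.

Definition answer (n : nat) (q : query n) : Type :=
  match q with Degree _ => nat | Neighbor _ _ => option 'I_n end.

(* Neighbors are numbered from 0; the answer to a neighbor query whose index is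
   not smaller than the degree is [None]. *)
Definition oracle (n : nat) (G : sgraph n) (L : adjlist G) (q : query n) :
    answer q :=
  match q with
  | Degree v => size (nbrs L v)
  | Neighbor v i => onth (nbrs L v) i
  end.

Variant input := InputG | InputH.

(* Deterministic adaptive query algorithms with oracle access to two graphs on n
   vertices, as decision trees; [Output true] means accept. *)
Inductive algorithm (n : nat) :=
  | Output of bool
  | Query (side : input) (q : query n) (next : answer q -> algorithm n).

Arguments Output {n}.
Arguments Query {n}.

Definition reply (n : nat) (G H : sgraph n) (LG : adjlist G) (LH : adjlist H)
    (side : input) (q : query n) : answer q :=
  match side with InputG => oracle LG q | InputH => oracle LH q end.

Fixpoint accepts (n : nat) (G H : sgraph n) (LG : adjlist G) (LH : adjlist H)
    (A : algorithm n) : bool :=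
  match A with
  | Output b => b
  | Query side q next => accepts LG LH (next (reply LG LH side q))
  end.

Fixpoint nqueries (n : nat) (G H : sgraph n) (LG : adjlist G) (LH : adjlist H)
    (A : algorithm n) : nat :=
  match A with
  | Output _ => 0
  | Query side q next => (nqueries LG LH (next (reply LG LH side q))).+1
  end.

Local Open Scope classical_set_scope.

(* A random choice, on an arbitrary probability space, of a deterministic
   algorithm. *)
Record randomized (R : realType) (n : nat) := Randomized {
  seed_display : measure_display;
  seed : measurableType seed_display;
  seed_prob : probability seed R;
  run : seed -> algorithm n;
  measurable_accepts : forall (G H : sgraph n) (LG : adjlist G) (LH : adjlist H),
    measurable [set w | accepts LG LH (run w)] }.

Local Open Scope ring_scope.

(* The forest H and its adjacency lists are fixed; only G varies. *)
Definition isomorphism_tester (R : realType) (n : nat) (eps : R)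
    (H : sgraph n) (LH : adjlist H) (A : randomized R n) : Prop :=
  forall (G : sgraph n) (LG : adjlist G), forest G ->
    (isomorphic G H ->
      ((2 / 3)%:E <= seed_prob A [set w | accepts LG LH (run w)])%E) /\
    (eps * n%:R <= (dist G H)%:R ->
      ((2 / 3)%:E <= seed_prob A [set w | ~~ accepts LG LH (run w)])%E).

(* Main.v *)
Require Import Defs.
From mathcomp Require Import all_boot all_order all_algebra all_fingroup.
From mathcomp Require Import all_classical all_reals all_analysis.
From mathcomp Require Import measurable_realfun zify lra.

(* Let [N = m + 1] and cut [N 2^N] of the vertices into [N] clusters of [2^N]
   consecutive vertices. A map [f] from clusters to scales turns cluster [c] into
   disjoint stars with [2^(f c)] vertices each, laid out in a fixed way, so that a
   query about a vertex only reveals the value of [f] at its cluster.  [H] comes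
   from the identity; a permutation [f] gives a graph isomorphic to [H].  If the
   image of [f] has about half of the scales, then each missing scale accounts for
   [2^N / 2] in the sum over the vertices of the differences between the degrees,
   hence the graph is at distance [Omega(n)] from [H].

   Far inputs are [p \o fold s] with [p] a random permutation and [s] random in
   Z/N, where [fold s] identifies [x] with [s - x]: distinct points [x] and [y]
   are identified for the single value [s = x + y].  An algorithm reading [q]
   values of [f] thus sees a collision with probability at most [q^2 / N], and
   without a collision a far input looks like a permutation.  So [q^2] is at least
   of order [N], which is of order [ln n]. *)

Set Implicit Arguments.
Unset Strict Implicit.
Unset Printing Implicit Defensive.

Import Order.TTheory GRing.Theory Num.Theory.

(** * Degrees and edit distance *)

Section Graphs.
Variable n : nat.
Implicit Types (G H F : sgraph n) (u v : 'I_n) (r : rel 'I_n).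

Definition edges_of_rel r : {set {set 'I_n}} :=
  [set [set p.1; p.2] | p : 'I_n * 'I_n & (p.1 != p.2) && r p.1 p.2].

Lemma edges_of_relP r : [forall e in edges_of_rel r, #|e| == 2].
Proof.
apply/'forall_implyP => e /imsetP[[u v] /=]; rewrite inE /= => /andP[uv _] ->.
by rewrite cards2 uv.
Qed.

Definition graph_of_rel r : sgraph n := SGraph (edges_of_relP r).

Lemma adj_graph_of_rel r : symmetric r ->
  forall u v, adj (graph_of_rel r) u v = (u != v) && r u v.
Proof.
move=> rsym u v; rewrite /adj /=; apply/imsetP/idP => [[[a b]]|uv]; last first.
  by exists (u, v) => //; rewrite inE.
rewrite inE /= => /andP[ab rab] E.
have : u \in [set a; b] by rewrite -E !inE eqxx.
have : v \in [set a; b] by rewrite -E !inE eqxx orbT.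
have : a \in [set u; v] by rewrite E !inE eqxx.
have : b \in [set u; v] by rewrite E !inE eqxx orbT.
rewrite !inE => /orP[] /eqP Eb /orP[] /eqP Ea /orP[] /eqP Ev /orP[] /eqP Eu;
  subst; rewrite ?eqxx // in ab *; rewrite ?ab ?rab // eq_sym ab rsym //.
Qed.

Lemma adj_sym G : symmetric (adj G).
Proof. by move=> u v; rewrite /adj finset.setUC. Qed.

Lemma sorted_nbrs_uniq G v : uniq [seq u <- enum 'I_n | adj G v u].
Proof. by rewrite filter_uniq ?enum_uniq. Qed.

Lemma mem_sorted_nbrs G v u : (u \in [seq u <- enum 'I_n | adj G v u]) = adj G v u.
Proof. by rewrite mem_filter mem_enum inE andbT. Qed.

Definition sorted_adjlist G : adjlist G :=
  AdjList (sorted_nbrs_uniq G) (mem_sorted_nbrs G).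

Definition degree G v : nat := #|[set u | adj G v u]|.

(** Each neighbor [u] that [v] has in [F] only gives the new edge [[set v; u]]; as there are no
    loops, distinct [u] give distinct edges. *)
Lemma degree_le_new_edges F G v :
  degree F v - degree G v <= #|[set e in edges F :\: edges G | v \in e]|.
Proof.
set A := [set u | adj F v u]; set B := [set u | adj G v u].
have card_new : degree F v - degree G v <= #|A :\: B|.
  rewrite leq_subLR /degree -/A -/B -(cardsID B A) leq_add2r.
  by rewrite subset_leq_card // finset.subsetIr.
apply: leq_trans card_new _.
have inj : {in A :\: B &, injective (fun u => [set v; u])}.
  have nv u : adj F v u -> u != v.
    move=> vu; apply/eqP => uv; have /'forall_implyP/(_ _ vu) := edgesP F.
    by rewrite uv finset.setUid cards1.
  move=> a b; rewrite !inE => /andP[_ /nv av] _ E.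
  have : a \in [set v; b] by rewrite -E !inE eqxx orbT.
  by rewrite !inE (negPf av) => /eqP.
rewrite -(card_in_imset inj); apply: subset_leq_card; apply/fintype.subsetP => e.
by case/imsetP=> u; rewrite !inE /adj => uAB ->; rewrite uAB !inE eqxx.
Qed.

Lemma sum_incident (E : {set {set 'I_n}}) : (forall e, e \in E -> #|e| = 2) ->
  \sum_v #|[set e in E | v \in e]| = 2 * #|E|.
Proof.
move=> E2; under eq_bigr => v _ do rewrite -sum1dep_card big_mkcondr /=.
rewrite exchange_big /= mulnC -sum_nat_const.
apply: eq_bigr => e /E2 <-.
by rewrite -sum1_card [in RHS]big_mkcond.
Qed.

(** An edited edge counts at both of its ends, whence the factor 2. Subtraction is truncated, so
    each summand is an absolute difference. *)
Lemma sum_degree_diff_le_edits G F :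
  \sum_v ((degree F v - degree G v) + (degree G v - degree F v)) <= 2 * edits G F.
Proof.
have E2 F' G' e : e \in edges F' :\: edges G' -> #|e| = 2.
  by rewrite inE => /andP[_ eF]; have /'forall_implyP/(_ _ eF)/eqP := edgesP F'.
rewrite big_split /= /edits mulnDr.
rewrite -(sum_incident (E2 F G)) -(sum_incident (E2 G F)).
by apply: leq_add; apply: leq_sum => v _; apply: degree_le_new_edges.
Qed.

Lemma degree_iso G H (s : {perm 'I_n}) :
  (forall u v, adj G u v = adj H (s u) (s v)) ->
  forall v, degree G v = degree H (s v).
Proof.
move=> sE v; rewrite /degree -(card_imset _ (@perm_inj _ s)); congr #|pred_of_set _|.
apply/finset.setP => u; apply/imsetP/idP => [[w]|]; rewrite inE.
  by rewrite sE => ? ->; rewrite inE.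
by move=> vu; exists ((s^-1)%g u); rewrite ?permKV // inE sE permKV.
Qed.

Lemma leq_dist k G H : (forall F, isomorphic F H -> k <= edits G F) ->
  k <= dist G H.
Proof.
move=> kle; rewrite /dist; elim/big_ind: _ => // [|x y kx ky].
- apply: kle; apply/existsP; exists 1%g.
  by apply/forallP => u; apply/forallP => v; rewrite !perm1.
- by rewrite minEnat leq_min kx ky.
Qed.

End Graphs.

(** * Injections, foldings and collisions *)

(** Induction on the points: composing [p] with [tperm (p x) (h x)] corrects the value at a new
    point [x] and, by injectivity, moves no earlier value. *)
Lemma perm_extending (T : finType) (X : {set T}) (h : T -> T) :
  {in X &, injective h} -> exists p : {perm T}, {in X, p =1 h}.
Proof.
suff ext (s : seq T) : uniq s -> {in s &, injective h} ->
    exists p : {perm T}, {in s, p =1 h}.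
  move=> hinj; have [||p pE] := ext (enum X); first exact: enum_uniq.
    by move=> x y; rewrite !mem_enum; apply: hinj.
  by exists p => x xX; apply: pE; rewrite mem_enum.
elim: s => [|x s IHs] /=; first by exists 1%g.
case/andP=> xs us hinj; have [//||p pE] := IHs.
  by move=> y z ys zs; apply: hinj; rewrite inE ?ys ?zs orbT.
exists (p * tperm (p x) (h x))%g => y; rewrite permM inE.
case: (eqVneq y x) => [-> _|yx /= ys]; first by rewrite tpermL.
rewrite (pE _ ys) tpermD //; first by rewrite -(pE _ ys) (inj_eq perm_inj) eq_sym.
rewrite eq_sym; apply: contraNneq yx => /hinj -> //; rewrite inE ?eqxx //.
by rewrite ys orbT.
Qed.

Section Fold.
Variable m : nat.
Implicit Types s x y : 'I_m.+1.

Definition fold s x : 'I_m.+1 := if x <= (s - x)%R then x else (s - x)%R.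

Lemma fold_collision s x y : fold s x = fold s y -> x = y \/ s = (x + y)%R.
Proof.
rewrite /fold; case: ifP => _; case: ifP => _ E.
- by left.
- by right; rewrite E subrK.
- by right; rewrite -E addrC subrK.
- by left; move: E => /addrI/oppr_inj.
Qed.

(** The image lies in the set [A] of points not above their reflection [s - x]. [A] and its
    reflection [B] have the same size and share only fixed points, at most two in number. *)
Lemma card_fold_image s : 2 * #|[set fold s x | x : 'I_m.+1]| <= m.+1 + 2.
Proof.
pose A := [set x : 'I_m.+1 | x <= (s - x)%R].
pose B := [set (s - x)%R | x in A].
(* A fixed point satisfies [x + x = s] modulo [m.+1], so as a natural number [x + x] is [s] or
   [s + m.+1]. *)
pose C : {set 'I_m.+1} := [set inord (s./2); inord ((s + m.+1)./2)].
have sK x : (s - (s - x))%R = x by rewrite subKr.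
have imA : [set fold s x | x : 'I_m.+1] \subset A.
  apply/fintype.subsetP => y /imsetP[x _ ->]; rewrite inE /fold.
  by case: ifP => // /negbT; rewrite -ltnNge sK => /ltnW.
have cB : #|B| = #|A| by rewrite card_imset // => x y /addrI/oppr_inj.
have AB : A :&: B \subset C.
  apply/fintype.subsetP => x; rewrite !inE => /andP[xle /imsetP[y]].
  rewrite inE => yle xE; rewrite -xE in yle.
  have yE : y = (s - x)%R by rewrite xE sK.
  rewrite yE in yle.
  have E : x = (s - x)%R by apply/val_inj/eqP; rewrite eqn_leq xle yle.
  have /(congr1 val) : (x + x)%R = s by rewrite {1}E subrK.
  rewrite /= => sE; have := ltn_ord x; have := ltn_ord s.
  move=> ls lx; apply/orP.
  case: (ltnP (x + x) m.+1) => [lt|ge].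
    left; rewrite modn_small // in sE; apply/eqP/val_inj; rewrite /= inordK; lia.
  right; have E2 : x + x - m.+1 = s.
    by rewrite -sE -[in RHS](subnK ge) modnDr modn_small //; lia.
  by apply/eqP/val_inj; rewrite /= inordK; lia.
have UA : #|A :|: B| <= m.+1 by rewrite -[X in _ <= X]card_ord max_card.
have C2 : #|C| <= 2 by rewrite cards2; case: eqP.
apply: leq_trans (leq_mul (leqnn 2) (subset_leq_card imA)) _.
rewrite mul2n -addnn -{2}cB -cardsUI leq_add //.
exact: leq_trans (subset_leq_card AB) C2.
Qed.

End Fold.

Section Collisions.
Variables (m : nat) (acc : ('I_m.+1 -> 'I_m.+1) -> bool).
Variable trace : ('I_m.+1 -> 'I_m.+1) -> {set 'I_m.+1}.
Hypothesis trace_local : forall f g, {in trace f, f =1 g} ->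
  trace g = trace f /\ acc g = acc f.

(* When [fold s] is injective on the points read on input [p], it extends there
   to a permutation [e], and [p * e^-1], read through [fold s], looks like [p];
   [p] is recovered because [e] depends on [s] and on the points read only. *)
Lemma card_acc_fold s :
  #|[set p : {perm 'I_m.+1} | acc p && dinjectiveb (fold s) (trace p)]| <=
  #|[set p : {perm 'I_m.+1} | acc (p \o fold s)]|.
Proof.
pose e (X : {set 'I_m.+1}) : {perm 'I_m.+1} :=
  odflt 1%g [pick p : {perm 'I_m.+1} | [forall x in X, p x == fold s x]].
have eE (X : {set 'I_m.+1}) : dinjectiveb (fold s) X -> {in X, e X =1 fold s}.
  move=> /dinjectiveP /perm_extending[p pE]; rewrite /e.
  case: pickP => [q /'forall_implyP qE x /qE/eqP //|/(_ p)/negP[]].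
  by apply/'forall_implyP => x /pE ->.
pose t (p : {perm 'I_m.+1}) : {perm 'I_m.+1} := ((e (trace p))^-1 * p)%g.
have tE (p : {perm 'I_m.+1}) : dinjectiveb (fold s) (trace p) ->
    {in trace p, p =1 t p \o fold s}.
  by move=> /eE pE x xX; rewrite /= permM -pE // permK.
have tinj : {in [set p : {perm 'I_m.+1} | acc p && dinjectiveb (fold s) (trace p)] &,
    injective t}.
  move=> p q; rewrite !inE => /andP[_ /tE pE] /andP[_ /tE qE] tpq.
  have [tp _] := trace_local pE; have [tq _] := trace_local qE.
  have tr : trace p = trace q by rewrite -tp tpq tq.
  by move: tpq; rewrite /t tr => /mulgI.
rewrite -(card_in_imset tinj); apply: subset_leq_card; apply/fintype.subsetP => q.
case/imsetP=> p; rewrite !inE => /andP[ap /tE pE] ->.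
by have [_ ->] := trace_local pE.
Qed.

(** Every [s] that causes a collision is a sum of two points of [X]. *)
Lemma card_not_dinjective (X : {set 'I_m.+1}) :
  #|[set s | ~~ dinjectiveb (fold s) X]| <= #|X| ^ 2.
Proof.
rewrite expnS expn1 -cardsX.
apply: leq_trans (leq_imset_card (fun p => p.1 + p.2)%R _).
apply: subset_leq_card; apply/fintype.subsetP => s; rewrite inE => ninj.
apply/imsetP; apply: contrapT => no; case/negP: ninj.
apply/dinjectiveP => x y xX yX /fold_collision[//|sE]; case: no.
by exists (x, y); rewrite ?inE ?xX.
Qed.

(** After exchanging the sums: for each accepted [p], at most a quarter of the values of [s] cause a
    collision on its trace. *)
Lemma sum_card_acc_fold :
    (forall p : {perm 'I_m.+1}, 4 * #|trace p| ^ 2 <= m.+1) ->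
  3 * m.+1 * #|[set p : {perm 'I_m.+1} | acc p]| <=
  4 * \sum_(s : 'I_m.+1) #|[set p : {perm 'I_m.+1} | acc (p \o fold s)]|.
Proof.
move=> small.
have : \sum_(s : 'I_m.+1)
    #|[set p : {perm 'I_m.+1} | acc p && dinjectiveb (fold s) (trace p)]| <=
    \sum_(s : 'I_m.+1) #|[set p : {perm 'I_m.+1} | acc (p \o fold s)]|.
  by apply: leq_sum => s _; apply: card_acc_fold.
rewrite -(leq_pmul2l (isT : 0 < 4)); apply: leq_trans.
under eq_bigr => s _ do rewrite -sum1dep_card.
rewrite (exchange_big_dep (fun p : {perm 'I_m.+1} => acc p)) /=; last first.
  by move=> s p _ /andP[].
rewrite -sum1dep_card !big_distrr /=; apply: leq_sum => p ap.
under eq_bigl => s do rewrite ap /=.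
rewrite sum1dep_card muln1.
have := card_not_dinjective (trace p); have := small p.
have := cardsC [set s | dinjectiveb (fold s) (trace p)].
rewrite card_ord (_ : finset.setC _ = [set s | ~~ dinjectiveb (fold s) (trace p)]).
  lia.
by apply/finset.setP => s; rewrite !inE.
Qed.

End Collisions.

(** * Star forests *)

Lemma divn_eqE d k b : 0 < d -> (b %/ d == k) = (k * d <= b < k.+1 * d).
Proof. by move=> d0; rewrite eqn_leq -ltnS ltn_divLR // leq_divRL // andbC. Qed.

Lemma card_ord_itv n a b : b <= n -> #|[set u : 'I_n | a <= u < b]| = b - a.
Proof.
move=> bn; rewrite -sum1dep_card -[in RHS](minn_idPl bn) {bn}.
elim: n => [|n IHn]; first by rewrite big_ord0; lia.
by rewrite big_mkcond big_ord_recr /= -big_mkcond /= IHn; case: ifP; lia.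
Qed.

(** The nearest other power of two is [2 ^ i.-1]. *)
Lemma double_exp_gap i j : 0 < i -> i != j ->
  2 ^ i.-1 <= (2 ^ i - 1 - (2 ^ j - 1)) + (2 ^ j - 1 - (2 ^ i - 1)).
Proof.
case: i => // i _ /=; rewrite neq_ltn => /orP[|] ij.
  by have := leq_pexp2l (isT : 0 < 2) ij; rewrite !expnS; have := expn_gt0 2 i; lia.
by have := leq_pexp2l (isT : 0 < 2) ij; rewrite !expnS; have := expn_gt0 2 j; lia.
Qed.

(* Intervals [[k 2^i, (k+1) 2^i)] carry stars centered at their left ends. *)
Definition star i : rel nat := fun a b =>
  (a != b) && ((a %/ 2 ^ i * 2 ^ i == b) || (b %/ 2 ^ i * 2 ^ i == a)).

Lemma star_sym i : symmetric (star i).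
Proof. by move=> a b; rewrite /star eq_sym orbC. Qed.

Lemma star_leaf i a b : star i a b -> ~~ (2 ^ i %| a) -> b = a %/ 2 ^ i * 2 ^ i.
Proof. by case/andP=> _ /orP[/eqP-> //|/eqP <-]; rewrite dvdn_mull. Qed.

(** Multiples of [2 ^ i] are their own centers, so two adjacent ones would be equal. *)
Lemma star_has_leaf i a b : star i a b -> ~~ (2 ^ i %| a) || ~~ (2 ^ i %| b).
Proof.
case/andP=> ab; rewrite -negb_and; apply: contraL => /andP[/divnK -> /divnK ->].
by rewrite orbC eq_sym orbb.
Qed.

Lemma star_center i a b : 2 ^ i %| a -> star i a b = (a < b < a + 2 ^ i).
Proof.
case/dvdnP=> k ->; have P0 : 0 < 2 ^ i by rewrite expn_gt0.
rewrite /star mulnK // eqn_pmul2r // divn_eqE // mulSn addnC.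
by case: (ltngtP (k * 2 ^ i) b) => //= ?; rewrite ?andbF.
Qed.

Section StarForest.
Variables n m : nat.
Implicit Types (f g : 'I_m.+1 -> 'I_m.+1) (u v w : 'I_n).
Local Notation D := (2 ^ m.+1).

(* Vertices outside the [m.+1] clusters get scale 0, hence are isolated. *)
Definition scale f (c : nat) : nat := if c < m.+1 then val (f (inord c)) else 0.

Definition stars_rel f : rel 'I_n := fun u v =>
  (u %/ D == v %/ D) && star (scale f (u %/ D)) (u %% D) (v %% D).

Definition stars f : sgraph n := graph_of_rel (stars_rel f).

Lemma adj_stars f u v : adj (stars f) u v = stars_rel f u v.
Proof.
rewrite adj_graph_of_rel; last first.
  move=> a b; rewrite /stars_rel eq_sym; case: eqP => //= ->.
  by rewrite star_sym.
by case: eqP => //= ->; rewrite /stars_rel /star !eqxx.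
Qed.

Lemma leaf_neighbor_uniq f u v w : ~~ (2 ^ scale f (u %/ D) %| u %% D) ->
  adj (stars f) u v -> adj (stars f) u w -> v = w.
Proof.
move=> lf; rewrite !adj_stars => /andP[/eqP uv /star_leaf /(_ lf) vE].
move=> /andP[/eqP uw /star_leaf /(_ lf) wE].
by apply: val_inj; rewrite /= (divn_eq v D) (divn_eq w D) -uv -uw vE wE.
Qed.

(** One end of the first edge of a cycle is a leaf, yet it has two distinct neighbors on the
    cycle. *)
Lemma forest_stars f : forest (stars f).
Proof.
case=> [|x [|y [|z c]]] // _ /andP[cyc /=].
rewrite !inE !negb_or -!andbA => /and5P[xy xz xc yz /andP[yc _]].
move: cyc; rewrite /= rcons_path => /and4P[xy_ yz_ _ lx].
have := xy_; rewrite adj_stars => /andP[/eqP xyD /star_has_leaf /orP[xl|yl]].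
  rewrite adj_sym in lx.
  have yE := leaf_neighbor_uniq xl xy_ lx.
  have : last z c \in z :: c by apply: mem_last.
  by rewrite -yE inE (negPf yz) (negPf yc).
rewrite xyD in yl; rewrite adj_sym in xy_.
by move: xz; rewrite (leaf_neighbor_uniq yl xy_ yz_) eqxx.
Qed.

(** * Degrees of star forests, their distance and isomorphism to [stars id] *)

Section Degrees.
Hypothesis Dn : m.+1 * D <= n.

Lemma scale_dvd f c : 2 ^ scale f c %| D.
Proof. by rewrite dvdn_exp2l // /scale; case: ifP => // _; apply: ltnW (ltn_ord _). Qed.

Lemma degree_center f v : 2 ^ scale f (v %/ D) %| v %% D ->
  degree (stars f) v = 2 ^ scale f (v %/ D) - 1.
Proof.
set P := 2 ^ _ => cv; have D0 : 0 < D by rewrite expn_gt0.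
have P0 : 0 < P by rewrite expn_gt0.
(* [P] divides [D], so the star does not overrun its cluster. *)
have rD : v %% D + P <= D.
  case/dvdnP: cv (ltn_pmod v D0) => k ->; case/dvdnP: (scale_dvd f (v %/ D)) => l.
  rewrite -/P => ->; rewrite ltn_mul2r P0 /= => kl.
  by rewrite addnC -mulSn leq_mul2r kl orbT.
(* Inside the clusters this follows from [Dn]; outside, [P] is 1. *)
have vP : v + P <= n.
  rewrite /P /scale in rD *; case: ifP rD => [lt rD|_ _]; last first.
    by rewrite expn0 addn1.
  apply: leq_trans Dn; rewrite {1}(divn_eq v D) -addnA.
  by apply: leq_trans (leq_mul lt (leqnn D)); rewrite mulSn addnC leq_add2r.
have <- : v + P - v.+1 = P - 1 by lia.
rewrite -(card_ord_itv _ vP); apply: eq_card => u; rewrite !inE adj_stars.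
rewrite /stars_rel star_center // -/P eq_sym.
have vE := divn_eq v D; have uE := divn_eq u D.
apply/andP/idP => [[/eqP E ub]|ub]; first by rewrite E in uE; lia.
have E : u %/ D == v %/ D by rewrite divn_eqE // mulSn; lia.
by split=> //; rewrite (eqP E) in uE; lia.
Qed.

(** The alternative [j < 2] covers leaves and the isolated vertices outside the clusters. *)
Lemma degree_stars f v :
  exists2 j, degree (stars f) v = 2 ^ j - 1 & j < 2 \/ exists x, j = f x.
Proof.
have [cv|lv] := boolP (2 ^ scale f (v %/ D) %| v %% D).
  exists (scale f (v %/ D)); first exact: degree_center.
  by rewrite /scale; case: ifP; [right; exists (inord (v %/ D)) | left].
have : degree (stars f) v <= 1.
  apply/card_le1P => u; rewrite inE => uv w; rewrite !inE.
  apply/idP/eqP => [vw|-> //]; exact: leaf_neighbor_uniq lv vw uv.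
case E : degree => [|[|//]] _; first by exists 0; [|left].
by exists 1; [|left].
Qed.

(** Counting the centers in cluster [i] suffices: there are [D / 2 ^ i] of them. *)
Lemma card_degree_stars_id (i : 'I_m.+1) : 0 < i ->
  D <= 2 * 2 ^ i.-1 * #|[set v | degree (stars id) v == 2 ^ i - 1]|.
Proof.
move=> i0; have D0 : 0 < D by rewrite expn_gt0.
have P0 : 0 < 2 ^ i by rewrite expn_gt0.
have DE : 2 ^ (m.+1 - i) * 2 ^ i = D by rewrite -expnD subnK // ltnW.
rewrite -expnS prednK // -DE mulnC leq_mul2l; apply/orP; right.
have lt_k (k : 'I_(2 ^ (m.+1 - i))) : k * 2 ^ i < D.
  by rewrite -DE ltn_pmul2r.
have lt_n (k : 'I_(2 ^ (m.+1 - i))) : i * D + k * 2 ^ i < n.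
  have := lt_k k; have : i.+1 * D <= m.+1 * D by rewrite leq_mul2r ltn_ord orbT.
  by rewrite mulSn; lia.
pose c (k : 'I_(2 ^ (m.+1 - i))) : 'I_n := Ordinal (lt_n k).
have cinj : injective c.
  move=> k l /(congr1 val) /= /addnI /eqP; rewrite eqn_pmul2r // => /eqP.
  exact: val_inj.
rewrite -[X in X <= _]card_ord -cardsT -(card_imset _ cinj) subset_leq_card //.
apply/fintype.subsetP => v /imsetP[k _ ->]; rewrite inE.
have cD : c k %/ D = i by rewrite /= divnMDl // divn_small // addn0.
have sE : scale id (c k %/ D) = i by rewrite /scale cD ltn_ord inord_val.
rewrite degree_center sE //= modnMDl modn_small //; exact: dvdn_mull.
Qed.

(** A copy [F] of [stars id] has at least [D / 2 ^ i] vertices of degree [2 ^ i - 1]. For a scale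
    [i] in [M], no vertex of [stars f] has this degree, so each of them contributes at least
    [2 ^ i.-1], together [D / 2]. *)
Lemma dist_stars f : 11 <= m -> 2 * #|[set f x | x : 'I_m.+1]| <= m.+1 + 2 ->
  m.+1 * D <= 16 * dist (stars f) (stars id).
Proof.
move=> m11 imf; have D0 : 0 < D by rewrite expn_gt0.
pose M := [set i : 'I_m.+1 | (2 <= i) && (i \notin [set f x | x : 'I_m.+1])].
(* Scales 0 and 1 are discarded because their degrees occur in any case; the remaining count
   [(m - 5) / 2] is at least [m.+1 / 4] once [m] is at least 11. *)
have cM : m.+1 <= 4 * #|M|.
  have : #|~: [set f x | x : 'I_m.+1]| <= #|M| + 2.
    have <- : #|[set i : 'I_m.+1 | 0 <= i < 2]| = 2 by rewrite card_ord_itv //; lia.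
    apply: leq_trans (leq_card_setU _ _).
    apply/subset_leq_card/fintype.subsetP => i; rewrite !inE => ->.
    by case: ltnP.
  have := cardsC [set f x | x : 'I_m.+1]; rewrite card_ord; lia.
(* Rounding up the quotient by 16 gives the bound the form that [leq_dist] needs. *)
have E16 X k : X <= 16 * k <-> (X + 15) %/ 16 <= k by lia.
apply/E16/leq_dist => F /existsP[s /forallP sE]; apply/E16.
have sadj u v : adj F u v = adj (stars id) (s u) (s v).
  by apply/eqP; have /forallP := sE u.
have degF v : degree F v = degree (stars id) (s v) := degree_iso sadj v.
have cardF i : #|[set v | degree F v == 2 ^ i - 1]| =
    #|[set v | degree (stars id) v == 2 ^ i - 1]|.
  rewrite -(card_imset _ (@perm_inj _ s)); apply: eq_card => v.
  apply/imsetP/idP => [[w]|]; rewrite !inE; first by rewrite degF => ? ->.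
  by move=> dv; exists ((s^-1)%g v); rewrite ?permKV // inE degF permKV.
(* The degree of [v] determines [i], so the sum has at most one term. *)
have gap v : \sum_(i in M | degree F v == 2 ^ i - 1) 2 ^ i.-1 <=
    (degree F v - degree (stars f) v) + (degree (stars f) v - degree F v).
  have [/pred0P none|] := boolP (pred0b [pred i in M | degree F v == 2 ^ i - 1]).
    by rewrite big_pred0.
  case/pred0Pn=> i /= /andP[iM /eqP di]; rewrite (bigD1 i) /= ?iM ?di ?eqxx //.
  rewrite big1 ?addn0 => [|j /andP[/andP[_ /eqP ij]]]; last first.
    case/eqP; apply/val_inj/eqP; rewrite /= -(eqn_exp2l _ _ (isT : 1 < 2)).
    by have := expn_gt0 2 i; have := expn_gt0 2 j; lia.
  have [j -> jf] := degree_stars f v; move: iM; rewrite inE => /andP[i2 fi].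
  apply: double_exp_gap; first exact: ltnW.
  apply: contraNneq fi => ij; case: jf => [|[x jx]]; first by rewrite -ij ltnNge i2.
  by apply/imsetP; exists x; rewrite ?inE //; apply: val_inj; rewrite /= ij.
have : \sum_(i in M) 2 ^ i.-1 * #|[set v | degree F v == 2 ^ i - 1]| <=
    2 * edits (stars f) F.
  apply: leq_trans (sum_degree_diff_le_edits _ _).
  apply: leq_trans (leq_sum _ (fun v _ => gap v)).
  rewrite (exchange_big_dep (mem M)) /= => [|v i _ /andP[] //].
  by apply: leq_sum => i iM; rewrite iM /= sum_nat_cond_const mulnC cardsE.
have : \sum_(i in M) D <=
    \sum_(i in M) 2 * (2 ^ i.-1 * #|[set v | degree F v == 2 ^ i - 1]|).
  apply: leq_sum => i; rewrite inE => /andP[i2 _]; rewrite mulnA cardF.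
  exact/card_degree_stars_id/ltnW.
rewrite sum_nat_const -big_distrr /=; set S := \sum_(i in M) _ => MD Se.
apply: (@leq_trans (4 * (#|M| * D))); first by rewrite mulnA leq_mul2r cM orbT.
apply: leq_trans (leq_mul (leqnn 4) MD) _; rewrite mulnA.
by apply: leq_trans (leq_mul (leqnn 8) Se) _; rewrite mulnA.
Qed.

(** Cluster [c] is moved onto cluster [p c] with offsets kept; vertices outside the clusters stay
    fixed. *)
Lemma isomorphic_stars (p : {perm 'I_m.+1}) : isomorphic (stars p) (stars id).
Proof.
have D0 : 0 < D by rewrite expn_gt0.
pose h v := if v %/ D < m.+1 then p (inord (v %/ D)) * D + v %% D else v.
have hn v : h v < n.
  rewrite /h; case: ifP => // _; apply: leq_trans Dn.
  apply: leq_trans (leq_mul (ltn_ord (p (inord (v %/ D)))) (leqnn D)).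
  by rewrite mulSn addnC ltn_add2r ltn_pmod.
pose t v := Ordinal (hn v).
have tdiv v : t v %/ D = if v %/ D < m.+1 then val (p (inord (v %/ D))) else v %/ D.
  rewrite /= /h; case: ifP => //= _.
  by rewrite divnMDl // (divn_small (ltn_pmod _ D0)) addn0.
have tmod v : t v %% D = v %% D.
  by rewrite /= /h; case: ifP => // _; rewrite modnMDl modn_mod.
have tdiv_inj u v : t u %/ D = t v %/ D -> u %/ D = v %/ D.
  rewrite !tdiv; case: ifP => lu; case: ifP => lv //.
  - move/val_inj/perm_inj/(congr1 val); rewrite /= !inordK //.
  - by move=> E; rewrite -E ltn_ord in lv.
  - by move=> E; rewrite E ltn_ord in lu.
have tinj : injective t.
  move=> u v tuv; apply: val_inj; rewrite /= (divn_eq u D) (divn_eq v D).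
  by rewrite -(tmod u) -(tmod v) (tdiv_inj u v) tuv.
apply/existsP; exists (perm tinj); apply/forallP => u; apply/forallP => v.
rewrite !permE !adj_stars /stars_rel !tmod.
have -> : (t u %/ D == t v %/ D) = (u %/ D == v %/ D).
  by apply/eqP/eqP => [/tdiv_inj //|E]; rewrite !tdiv E.
apply/eqP; congr (_ && star _ _ _); rewrite tdiv /scale.
by case: ifP => [_|->] //; rewrite ltn_ord inord_val.
Qed.

End Degrees.

(** * Locality of query algorithms *)

Section Trace.
Variables (H : sgraph n) (LH : adjlist H).

Definition clusters (side : input) (q : query n) : {set 'I_m.+1} :=
  match side, q with
  | InputG, (Degree v | Neighbor v _) => [set c | val c == v %/ D]
  | InputH, _ => finset.set0
  end.

Local Notation L f := (sorted_adjlist (stars f)).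

Fixpoint trace (A : algorithm n) f : {set 'I_m.+1} :=
  match A with
  | Output _ => finset.set0
  | Query side q next =>
      clusters side q :|: trace (next (reply (L f) LH side q)) f
  end.

Lemma card_trace A f : #|trace A f| <= nqueries (L f) LH A.
Proof.
elim: A => [b|side q next IH] /=; first by rewrite cards0.
apply: leq_trans (leq_card_setU _ _) _; apply: (@leq_add _ _ 1) => //.
have le1 v : #|[set c : 'I_m.+1 | val c == v %/ D]| <= 1.
  apply/card_le1P => c; rewrite inE => /eqP cv d; rewrite !inE -cv.
  by apply/eqP/eqP => [/val_inj|->].
by case: side q {next IH} => -[v|v i] //=; rewrite cards0.
Qed.

(** With sorted lists, the neighbors of [v] and their order depend on [f] only at the cluster of
    [v]. *)
Lemma reply_local f g side q : {in clusters side q, f =1 g} ->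
  reply (L f) LH side q = reply (L g) LH side q.
Proof.
case: side => //= fg.
have nbrsE v : {in [set c : 'I_m.+1 | val c == v %/ D], f =1 g} ->
    nbrs (L f) v = nbrs (L g) v.
  move=> {}fg; apply: eq_filter => u; rewrite !adj_stars /stars_rel /scale.
  by case: ifP => // lt; rewrite fg // inE /= inordK.
by case: q fg => [v|v i] /= /nbrsE /= ->.
Qed.

(** Equal replies lead down the same branch of the decision tree. *)
Lemma trace_local A f g : {in trace A f, f =1 g} ->
  trace A g = trace A f /\ accepts (L g) LH A = accepts (L f) LH A.
Proof.
elim: A => [b|side q next IH] //= fg.
have rE : reply (L f) LH side q = reply (L g) LH side q.
  by apply: reply_local => c cq; apply: fg; rewrite inE cq.
rewrite -rE; have [|-> ->] // := IH (reply (L f) LH side q).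
by move=> c ct; apply: fg; rewrite inE ct orbT.
Qed.

End Trace.
End StarForest.

(** * Averaging over the random inputs *)

Local Open Scope ring_scope.
Section Expectation.
Variables (R : realType) (d : measure_display) (T : measurableType d).
Variable P : probability T R.

Lemma card_indic (I : finType) (A : I -> T -> bool) w :
  #|[set i | A i w]|%:R = \sum_i \1_[set w | A i w]%classic w :> R.
Proof.
rewrite -sum1dep_card natr_sum big_mkcond /=; apply: eq_bigr => i _.
rewrite indicE; case: ifP => Ai; first by rewrite mem_set.
by rewrite memNset //= Ai.
Qed.

Lemma expectation_card (I : finType) (A : I -> T -> bool) :
    (forall i, measurable [set w | A i w]%classic) ->
  (\int[P]_w (#|[set i | A i w]|%:R)%:E = (\sum_i fine (P [set w | A i w]%classic))%:E)%E.
Proof.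
move=> mA; under eq_integral => w _ do rewrite card_indic -sumEFin.
rewrite ge0_integral_sum //; last first.
  by move=> i; apply/measurable_EFinP; exact: measurable_indic.
rewrite -sumEFin; apply: eq_bigr => i _.
by rewrite integral_indic // setIT fineK // fin_num_measure.
Qed.

Lemma measurable_card (I : finType) (A : I -> T -> bool) :
    (forall i, measurable [set w | A i w]%classic) ->
  measurable_fun [set: T]%classic (fun w => (#|[set i | A i w]|%:R : R)%:E).
Proof.
move=> mA; under eq_fun => w do rewrite card_indic -sumEFin.
by apply: emeasurable_sum => i; apply/measurable_EFinP; exact: measurable_indic.
Qed.

(** A counting inequality valid for every seed is integrated; an expected count is a sum of
    probabilities. *)
Lemma sum_probability_le (I J : finType) (a b : nat)
    (A : I -> T -> bool) (B : J -> T -> bool) :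
    (forall i, measurable [set w | A i w]%classic) ->
    (forall j, measurable [set w | B j w]%classic) ->
    (forall w, a * #|[set i | A i w]| <= b * #|[set j | B j w]|)%N ->
  a%:R * \sum_i fine (P [set w | A i w]%classic) <=
  b%:R * \sum_j fine (P [set w | B j w]%classic).
Proof.
move=> mA mB AB; rewrite -lee_fin !EFinM -!expectation_card //.
rewrite -!ge0_integralZl_EFin //; try exact: measurable_card.
apply: ge0_le_integral => //.
- by apply: measurable_funeM; exact: measurable_card.
- by apply: measurable_funeM; exact: measurable_card.
- by move=> w _; rewrite -!EFinM lee_fin -!natrM ler_nat.
Qed.

End Expectation.

(** * Choice of the number of clusters and the query bound *)

(** Here [n] is at most [2 ^ (m.+2 + m.+2)], [ln 2 <= 1], and [m.+2 + m.+2] is at most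
    [4 * m.+1]. *)
Lemma ln_exp2_le (R : realType) m n : (n < m.+2 * 2 ^ m.+2)%N ->
  ln (n%:R : R) <= 4 * m.+1%:R.
Proof.
move=> nm; have [n0|n0] := leqP n 0.
  apply: (@le_trans _ _ 0); last by rewrite mulr_ge0 ?ler0n.
  by apply: ln_le0; rewrite lern1 (leq_trans n0).
have n2 : (n <= 2 ^ (m.+2 + m.+2))%N.
  by rewrite expnD (leq_trans (ltnW nm)) // leq_mul2r ltnW ?orbT // ltn_expl.
apply: (@le_trans _ _ (ln ((2 : R) ^+ (m.+2 + m.+2)))).
  by rewrite ler_ln ?posrE ?exprn_gt0 ?ltr0n // -natrX ler_nat.
rewrite lnXn // -[ln _]/(ln (1 + 1)) -(mulr_natr (ln _)).
have : ln (1 + 1 : R) <= 1 by apply: le_ln1Dx; lra.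
have : (m.+2 + m.+2)%:R = 2 * m.+1%:R + 2 :> R.
  by rewrite -natrM -natrD; congr _%:R; lia.
have : 1 <= m.+1%:R :> R by rewrite ler1n.
move=> m1 -> l1; apply: (@le_trans _ _ (1 * (2 * m.+1%:R + 2))); last lra.
by rewrite ler_wpM2r //; lra.
Qed.

(** The largest [m] whose clusters fit into [n] vertices; [m = 11] does. *)
Lemma ex_cluster_count n : (12 * 2 ^ 12 <= n)%N ->
  exists m, [/\ (11 <= m)%N, (m.+1 * 2 ^ m.+1 <= n)%N & (n < m.+2 * 2 ^ m.+2)%N].
Proof.
move=> n12; pose S m := (11 <= m)%N && (m.+1 * 2 ^ m.+1 <= n)%N.
have S11 : exists m, S m by exists 11%N.
have Sn m : S m -> (m <= n)%N.
  case/andP=> _ /(leq_trans _); apply.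
  by apply: leq_trans (leqnSn m) _; rewrite leq_pmulr // expn_gt0.
case: (ex_maxnP S11 Sn) => m /andP[m11 mn] mmax; exists m; split=> //.
rewrite ltnNge; apply/negP => mn'; have := mmax m.+1.
by rewrite /S mn' andbT (leqW m11) ltnn => /(_ isT).
Qed.

Theorem theorem2 (R : realType) :
  exists eps : R, 0 < eps /\
  exists c : R, 0 < c /\
  exists N : nat, forall n : nat, (N <= n)%N ->
  exists H : sgraph n, forest H /\
  forall (LH : adjlist H) (A : randomized R n),
    isomorphism_tester eps LH A ->
    exists (G : sgraph n) (LG : adjlist G) (w : seed A),
      forest G /\
      c * Num.sqrt (ln (n%:R : R)) <= (nqueries LG LH (run w))%:R.
Proof.
(* Far inputs are at distance at least [m.+1 * 2 ^ m.+1 / 16], and [n] is less than 4 times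
   [m.+1 * 2 ^ m.+1]. *)
exists (1 / 64); split; first by lra.
(* Fewer than [sqrt (ln n) / 4] queries give a trace of size [t] with
   [4 * t ^ 2 <= ln n / 4 <= m.+1]. *)
exists (1 / 4); split; first by lra.
exists (12 * 2 ^ 12)%N => n /ex_cluster_count[m [m11 mn nm]].
exists (stars n (@id 'I_m.+1)); split; first exact: forest_stars.
move=> LH A tester; apply: contrapT => few.
pose L (f : 'I_m.+1 -> 'I_m.+1) := sorted_adjlist (stars n f).
pose acc (w : seed A) f := accepts (L f) LH (run w).
have small (w : seed A) (f : 'I_m.+1 -> 'I_m.+1) :
    (4 * #|trace LH (run w) f| ^ 2 <= m.+1)%N.
  have : (nqueries (L f) LH (run w))%:R < 1 / 4 * Num.sqrt (ln (n%:R : R)).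
    rewrite ltNge; apply/negP => q; apply: few.
    by exists (stars n f), (L f), w; split=> //; exact: forest_stars.
  have := card_trace LH (run w) f.
  rewrite -(ler_nat R); set t : R := #|_|%:R => /le_lt_trans tq /tq {}tq.
  rewrite -(ler_nat R) natrM natrX -/t.
  have t0 : 0 <= t by rewrite ler0n.
  have ln0 : 0 <= ln (n%:R : R).
    by apply: ln_ge0; rewrite ler1n; apply: leq_trans mn; rewrite muln_gt0 expn_gt0.
  have : t ^+ 2 <= (1 / 4 * Num.sqrt (ln (n%:R : R))) ^+ 2.
    have c0 : (0 : R) <= 1 / 4 by lra.
    by rewrite ler_sqr ?nnegrE ?(mulr_ge0 c0) ?sqrtr_ge0 //; exact: ltW.
  rewrite exprMn sqr_sqrtr //; have := ln_exp2_le R nm; lra.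
pose p1 (p : {perm 'I_m.+1}) := fine (seed_prob A [set w | acc w p]%classic).
pose p2 (sp : 'I_m.+1 * {perm 'I_m.+1}) :=
  fine (seed_prob A [set w | acc w (sp.2 \o fold sp.1)]%classic).
have macc f : measurable [set w | acc w f]%classic by apply: measurable_accepts.
have Pfin f : seed_prob A [set w | acc w f]%classic \is a fin_num.
  by rewrite fin_num_measure.
have p1_ge p : 2 / 3 <= p1 p.
  have [+ _] := tester _ (L p) (@forest_stars n m p).
  move=> /(_ (isomorphic_stars mn p)).
  by rewrite -lee_fin fineK.
have p2_le sp : p2 sp <= 1 / 3.
  case: sp => s p; set f := p \o fold s.
  have [_] := tester _ (L f) (@forest_stars n m f).
  have far : (m.+1 * 2 ^ m.+1 <= 16 * dist (stars n f) (stars n (@id 'I_m.+1)))%N.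
    (* Applying [p^-1] keeps the size of the image and leaves the image of [fold s]. *)
    apply: dist_stars => //; rewrite -(card_imset _ (@perm_inj _ p^-1)).
    rewrite (_ : _ @: _ = [set fold s x | x : 'I_m.+1]) ?card_fold_image //.
    rewrite -imset_comp; apply: eq_imset => x; rewrite /= permK //.
  have /[swap]/[apply] :
      1 / 64 * n%:R <= (dist (stars n f) (stars n (@id 'I_m.+1)))%:R :> R.
    have : (n <= 64 * dist (stars n f) (stars n (@id 'I_m.+1)))%N.
      apply: leq_trans (ltnW nm) _; rewrite (_ : 64 = 4 * 16)%N // -mulnA.
      apply: leq_trans (leq_mul (leqnn 4) far).
      by rewrite expnS; lia.
    rewrite -(ler_nat R) natrM; lra.
  rewrite (_ : [set w | _] = ~` [set w | acc w f])%classic; last first.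
    by apply/seteqP; split=> w /= /negP.
  rewrite probability_setC // -[seed_prob A _]fineK // -EFinB lee_fin -/(p2 (s, p)).
  lra.
have := @sum_probability_le R _ _ (seed_prob A) _ _ (3 * m.+1) 4
  (fun (p : {perm 'I_m.+1}) w => acc w p)
  (fun (sp : 'I_m.+1 * {perm 'I_m.+1}) w => acc w (sp.2 \o fold sp.1))
  (fun p => macc p) (fun sp => macc _).
have count w : (3 * m.+1 * #|[set p : {perm 'I_m.+1} | acc w p]| <=
    4 * #|[set sp : 'I_m.+1 * {perm 'I_m.+1} | acc w (sp.2 \o fold sp.1)]|)%N.
  have loc f g := @trace_local n m _ LH (run w) f g.
  apply: leq_trans (@sum_card_acc_fold m (acc w) _ loc (small w)) _.
  rewrite leq_mul2l /= -sum1dep_card.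
  rewrite -(pair_big_dep predT
    (fun s (p : {perm 'I_m.+1}) => acc w (p \o fold s)) (fun _ _ => 1%N)).
  by apply: leq_sum => s _; rewrite sum1dep_card.
(* With [K] permutations, the left side is at least [2 * m.+1 * K], the right side at most
   [4 / 3 * m.+1 * K]. *)
move=> /(_ count); apply/negP; rewrite -ltNge.
set K := #|{: {perm 'I_m.+1}}|.
have K0 : 0 < K%:R :> R by rewrite ltr0n; apply/card_gt0P; exists 1%g.
have sum1 : K%:R * (2 / 3) <= \sum_p p1 p.
  by rewrite mulrC mulr_natr -sumr_const; apply: ler_sum.
have sum2 : \sum_sp p2 sp <= (m.+1 * K)%:R * (1 / 3).
  have <- : #|{: 'I_m.+1 * {perm 'I_m.+1}}| = (m.+1 * K)%N by rewrite card_prod card_ord.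
  by rewrite mulrC mulr_natr -sumr_const; apply: ler_sum.
have NK : 0 < m.+1%:R * K%:R :> R by rewrite mulr_gt0 // ltr0n.
apply: le_lt_trans (ler_wpM2l _ sum2) _; first by rewrite ler0n.
apply: lt_le_trans (ler_wpM2l _ sum1); last by rewrite ler0n.
rewrite !natrM; lra.
Qed.
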